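(* Let $\alpha,\beta\in\mathbb{R}$ and $\eta\in\{1,-1\}$, and let $(G_4,g,J)$ be the connected, simply connected three-dimensional Lorentzian Lie group with product structure $J$ whose Lie algebra $\mathfrak{g}$ has a pseudo-orthonormal basis $\{e_1,e_2,e_3\}$ ($e_3$ timelike) with $[e_1,e_2]=-e_2+(2\eta-\beta)e_3$, $[e_1,e_3]=-\beta e_2+e_3$, $[e_2,e_3]=\alpha e_1$. Then $(G_4,g,J)$ is not a first kind algebraic Ricci soliton associated to the Kobayashi-Nomizu connection $\nabla^1$.
   Context: The left-invariant Lorentzian metric $g$ satisfies $g(e_1,e_1)=g(e_2,e_2)=1$, $g(e_3,e_3)=-1$, $g(e_i,e_j)=0$ for $i\ne j$. All tensors and connections are left-invariant and evaluated on $\mathfrak{g}$. $\nabla$ is the Levi-Civita connection of $g$. The product structure is $Je_1=e_1$, $Je_2=e_2$, $Je_3=-e_3$, and $(\nabla_XJ)Y=\nabla_X(JY)-J(\nabla_XY)$. The canonical connection is $\nabla^0_XY=\nabla_XY-\frac12(\nabla_XJ)(JY)$ and the Kobayashi-Nomizu connection is $\nabla^1_XY=\nabla^0_XY-\frac14[(\nabla_YJ)(JX)-(\nabla_{JY}J)X]$, with curvature $R^1(X,Y)Z=\nabla^1_X\nabla^1_YZ-\nabla^1_Y\nabla^1_XZ-\nabla^1_{[X,Y]}Z$. Its Ricci tensor is $\rho^1(X,Y)=-g(R^1(X,e_1)Y,e_1)-g(R^1(X,e_2)Y,e_2)+g(R^1(X,e_3)Y,e_3)$ and the Ricci operator $\mathrm{Ric}^1$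 is defined by $\rho^1(X,Y)=g(\mathrm{Ric}^1(X),Y)$. First kind algebraic Ricci soliton associated to $\nabla^1$ means: $\mathrm{Ric}^1=c\,\mathrm{Id}+D$ for some real number $c$ and some derivation $D$ of $\mathfrak{g}$, i.e. a linear map with $D[X,Y]=[DX,Y]+[X,DY]$ for all $X,Y\in\mathfrak{g}$. *)

(* Defs.v *)
From HB Require Import structures.
From mathcomp Require Import all_boot all_order all_algebra.
From mathcomp Require Import reals.

Set Implicit Arguments.
Unset Strict Implicit.
Unset Printing Implicit Defensive.

Import GRing.Theory Num.Theory.
Local Open Scope ring_scope.

Record lieAlgebra (R : realType) := LieAlgebra {
  lie_space :> vectType R;
  bracket : {bilinear lie_space -> lie_space -> lie_space};
  bracket_alt : forall X, bracket X X = 0;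
  bracket_jacobi : forall X Y Z,
    bracket X (bracket Y Z) + bracket Y (bracket Z X)
      + bracket Z (bracket X Y) = 0
}.

Arguments bracket {R l}.

(* Left-invariant geometry of a Lie group, written on its Lie algebra: a
   left-invariant metric is a symmetric bilinear form, a left-invariant
   connection a bilinear map, and the derivative X (g (Y, Z)) vanishes because
   g (Y, Z) is constant for left-invariant Y and Z. *)
Section LeftInvariantGeometry.
Variables (R : realType) (L : lieAlgebra R) (g : {symmetric L}).
Variables (nabla : {bilinear L -> L -> L}) (J : 'End(L)) (e1 e2 e3 : L).
Implicit Types X Y Z : L.

Definition pseudo_orthonormal_basis : Prop :=
  [/\ basis_of {: L} [:: e1; e2; e3],
      [/\ g e1 e1 = 1, g e2 e2 = 1 & g e3 e3 = -1]
    & [/\ g e1 e2 = 0, g e1 e3 = 0 & g e2 e3 = 0]].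

Definition torsion_free : Prop :=
  forall X Y, nabla X Y - nabla Y X = bracket X Y.

Definition metric_compatible : Prop :=
  forall X Y Z, g (nabla X Y) Z + g Y (nabla X Z) = 0.

Definition levi_civita : Prop := torsion_free /\ metric_compatible.

Definition product_structure : Prop :=
  [/\ J e1 = e1, J e2 = e2 & J e3 = - e3].

Definition nablaJ X Y : L := nabla X (J Y) - J (nabla X Y).

Definition canonical_connection X Y : L :=
  nabla X Y - 2^-1 *: nablaJ X (J Y).

Definition kobayashi_nomizu X Y : L :=
  canonical_connection X Y - 4^-1 *: (nablaJ Y (J X) - nablaJ (J Y) X).

Definition kn_curvature X Y Z : L :=
  kobayashi_nomizu X (kobayashi_nomizu Y Z)
  - kobayashi_nomizu Y (kobayashi_nomizu X Z)
  - kobayashi_nomizu (bracket X Y) Z.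

Definition kn_ricci X Y : R :=
  - g (kn_curvature X e1 Y) e1 - g (kn_curvature X e2 Y) e2
  + g (kn_curvature X e3 Y) e3.

Definition kn_ricci_operator (Ric : 'End(L)) : Prop :=
  forall X Y, kn_ricci X Y = g (Ric X) Y.

Definition derivation (D : 'End(L)) : Prop :=
  forall X Y, D (bracket X Y) = bracket (D X) Y + bracket X (D Y).

Definition first_kind_algebraic_ricci_soliton (Ric : 'End(L)) : Prop :=
  exists (c : R) (D : 'End(L)), derivation D /\ Ric = c *: \1%VF + D.

End LeftInvariantGeometry.

(* Main.v *)
Require Import Defs.
From mathcomp Require Import all_boot all_order all_algebra reals.
From mathcomp Require Import ring lra.

Set Implicit Arguments.
Unset Strict Implicit.
Unset Printing Implicit Defensive.

Import GRing.Theory Num.Theory.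
Local Open Scope ring_scope.

(* In the frame (e1, e2, e3), with b := 2 eta - beta and t := beta - eta, the
   Koszul formula yields the Levi-Civita connection, from which
   Ric^1 e1 = (b beta - 1) e1, Ric^1 e2 = (alpha b - 1) e2 - alpha e3 and
   Ric^1 e3 = 0.  If Ric^1 - c Id is a derivation, the e2-component on [e1, e2]
   forces c = - alpha beta - t^2, and the remaining relations become
   beta (2 alpha t + 1) = 0, b + 2 alpha eta t = 0 and
   alpha (1 - 2 t^2 - 2 alpha eta) = 0.  If beta = 0, the second gives
   alpha = eta, against the third; if 2 alpha t = -1, the second gives t = 0. *)

Lemma bracketC (R : realType) (L : lieAlgebra R) (X Y : L) :
  bracket X Y = - bracket Y X.
Proof.
have := bracket_alt (X + Y).
rewrite linearDl !linearDr !bracket_alt add0r addr0 => /eqP.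
by rewrite addr_eq0 => /eqP.
Qed.

Lemma formC (R : realType) (L : lieAlgebra R) (g : {symmetric L}) (X Y : L) :
  g X Y = g Y X.
Proof. by rewrite hermC expr0 mul1r. Qed.

Lemma formZr (R : realType) (L : lieAlgebra R) (g : {symmetric L}) (X Y : L) a :
  g X (a *: Y) = a * g X Y.
Proof. by rewrite formC linearZl_LR /= formC. Qed.

(** Torsion-freeness turns each bracket into a difference of covariant derivatives, and metric
    compatibility on the three cyclic permutations of [X, Y, Z] pairs off the unwanted terms. No
    derivatives of [g] appear, by left-invariance. *)
Lemma koszul (R : realType) (L : lieAlgebra R) (g : {symmetric L})
    (nabla : {bilinear L -> L -> L}) (nabla_LC : levi_civita g nabla)
    (X Y Z : L) :
  g (nabla X Y) Z =
    2^-1 * (g (bracket X Y) Z - g (bracket Y Z) X + g (bracket Z X) Y).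
Proof.
case: nabla_LC => tf mc; rewrite -!tf !linearBl.
have := mc X Y Z; have := mc Y Z X; have := mc Z X Y.
rewrite [g Z _]formC [g X (nabla _ _)]formC [g Y (nabla _ _)]formC.
by move=> h1 h2 h3; lra.
Qed.

Section Frame.
Variables (R : realType) (L : lieAlgebra R) (e1 e2 e3 : L).

Definition frame (x y z : R) : L := x *: e1 + y *: e2 + z *: e3.

Lemma frameD x y z x' y' z' :
  frame x y z + frame x' y' z' = frame (x + x') (y + y') (z + z').
Proof. by rewrite /frame !scalerDl addrACA [X in X + _]addrACA. Qed.

Lemma frameZ a x y z : a *: frame x y z = frame (a * x) (a * y) (a * z).
Proof. by rewrite /frame !scalerDr !scalerA. Qed.

Lemma frameN x y z : - frame x y z = frame (- x) (- y) (- z).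
Proof. by rewrite -scaleN1r frameZ !mulN1r. Qed.

Definition frameE := (frameN, frameD, frameZ).

Lemma frame_e1 : e1 = frame 1 0 0.
Proof. by rewrite /frame scale1r !scale0r !addr0. Qed.

Lemma frame_e2 : e2 = frame 0 1 0.
Proof. by rewrite /frame scale1r !scale0r add0r addr0. Qed.

Lemma frame_e3 : e3 = frame 0 0 1.
Proof. by rewrite /frame scale1r !scale0r !add0r. Qed.

Lemma linear_frame (f : {linear L -> L}) x y z :
  f (frame x y z) = x *: f e1 + y *: f e2 + z *: f e3.
Proof. by rewrite /frame !linearD !linearZ. Qed.

Lemma bilinear_frame (f : {bilinear L -> L -> L}) x y z x' y' z' :
  f (frame x y z) (frame x' y' z') =
    x *: (x' *: f e1 e1 + y' *: f e1 e2 + z' *: f e1 e3)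
    + y *: (x' *: f e2 e1 + y' *: f e2 e2 + z' *: f e2 e3)
    + z *: (x' *: f e3 e1 + y' *: f e3 e2 + z' *: f e3 e3).
Proof.
by rewrite {1}/frame !linearDl !linearZl_LR /= /frame !linearDr !linearZr_LR.
Qed.

Variables (g : {symmetric L}) (basis_e : pseudo_orthonormal_basis g e1 e2 e3).

Lemma form_frame x y z x' y' z' :
  g (frame x y z) (frame x' y' z') = x * x' + y * y' - z * z'.
Proof.
case: basis_e => _ [g11 g22 g33] [g12 g13 g23].
rewrite /frame !linearDl !linearZl_LR /= !linearDr /= !formZr.
by rewrite [g e2 e1]formC [g e3 e1]formC [g e3 e2]formC
  g11 g22 g33 g12 g13 g23; ring.
Qed.

(** Turns values of the form, which is all that the Koszul formula and [kn_ricci_operator] provide,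
    into coordinates. The last sign comes from [e3] being timelike. *)
Lemma frame_form X :
  X = frame (g X (frame 1 0 0)) (g X (frame 0 1 0)) (- g X (frame 0 0 1)).
Proof.
have [/coord_basis/(_ (memvf X)) defX _ _] := basis_e.
have {defX} [x [y [z ->]]] : exists x y z, X = frame x y z.
  rewrite defX !big_ord_recl big_ord0 addr0 /= addrA.
  by do 3 eexists.
by rewrite !form_frame; congr frame; ring.
Qed.

Lemma frame_inj x y z x' y' z' :
  frame x y z = frame x' y' z' -> [/\ x = x', y = y' & z = z'].
Proof.
move=> eqF.
have h w := congr1 (g^~ w) eqF.
move: (h (frame 1 0 0)) (h (frame 0 1 0)) (h (frame 0 0 1)) => /=.
by rewrite !form_frame => h1 h2 h3; split; lra.
Qed.

End Frame.

Section G4.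
Variables (R : realType) (alpha beta eta : R) (L : lieAlgebra R).
Variables (g : {symmetric L}) (e1 e2 e3 : L).
Hypothesis basis_e : pseudo_orthonormal_basis g e1 e2 e3.
Hypothesis bracket12 : bracket e1 e2 = - e2 + (2 * eta - beta) *: e3.
Hypothesis bracket13 : bracket e1 e3 = - beta *: e2 + e3.
Hypothesis bracket23 : bracket e2 e3 = alpha *: e1.
Variables (J : 'End(L)) (nabla : {bilinear L -> L -> L}).
Hypothesis J_prod : product_structure J e1 e2 e3.
Hypothesis nabla_LC : levi_civita g nabla.

Local Notation fr := (frame e1 e2 e3).

Lemma bracket_frame x y z x' y' z' :
  bracket (fr x y z) (fr x' y' z') =
    fr (alpha * (y * z' - z * y'))
       (- (x * y' - y * x') - beta * (x * z' - z * x'))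
       ((2 * eta - beta) * (x * y' - y * x') + (x * z' - z * x')).
Proof.
rewrite bilinear_frame !bracket_alt [bracket e2 e1]bracketC.
rewrite [bracket e3 e1]bracketC [bracket e3 e2]bracketC.
rewrite bracket12 bracket13 bracket23.
have -> : - e2 + (2 * eta - beta) *: e3 = fr 0 (-1) (2 * eta - beta).
  by rewrite /frame scale0r add0r scaleN1r.
have -> : - beta *: e2 + e3 = fr 0 (- beta) 1.
  by rewrite /frame scale0r add0r scale1r.
have -> : alpha *: e1 = fr alpha 0 0 by rewrite /frame !scale0r !addr0.
have -> : (0 : L) = fr 0 0 0 by rewrite /frame !scale0r !addr0.
by rewrite !(frameE e1 e2 e3); congr (frame _ _ _ _ _ _); ring.
Qed.

Lemma J_frame x y z : J (fr x y z) = fr x y (- z).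
Proof.
case: J_prod => J1 J2 J3.
by rewrite linear_frame /= J1 J2 J3 /frame scalerN scaleNr.
Qed.

Lemma nabla_frame x y z x' y' z' :
  let s := 2^-1 * alpha in let t := beta - eta in
  nabla (fr x y z) (fr x' y' z') =
    fr (- y * y' + (s - eta) * y * z' - (s + eta) * z * y' - z * z')
       ((s - t) * x * z' + y * x' + (s + eta) * z * x')
       ((s - t) * x * y' + (s - eta) * y * x' - z * x').
Proof.
move=> s t; rewrite [LHS](frame_form basis_e) !(koszul nabla_LC).
rewrite !bracket_frame !(form_frame basis_e) /s /t.
by congr (frame _ _ _ _ _ _); field.
Qed.

(** The connection preserves both eigenspaces of [J]: the first two coordinates involve only [x']
    and [y'], the last only [z']. Between vectors of different eigenspaces it is the bracket
    projected to the eigenspace of the second argument. *)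
Lemma kn_frame x y z x' y' z' :
  kobayashi_nomizu nabla J (fr x y z) (fr x' y' z') =
    fr (- y * y' - alpha * z * y')
       (y * x' + beta * z * x')
       (x * z').
Proof.
rewrite /kobayashi_nomizu /canonical_connection /nablaJ.
rewrite !J_frame !nabla_frame !J_frame !(frameE e1 e2 e3).
by congr (frame _ _ _ _ _ _); field.
Qed.

(** The term [alpha * y * z'] has no counterpart in [z * y'], so this Ricci tensor is symmetric only
    for [alpha = 0], and the order of its arguments matters for the operator. *)
Lemma kn_ricci_frame x y z x' y' z' :
  kn_ricci g nabla J e1 e2 e3 (fr x y z) (fr x' y' z') =
    ((2 * eta - beta) * beta - 1) * x * x'
    + (alpha * (2 * eta - beta) - 1) * y * y' + alpha * y * z'.
Proof.
pose K X Z (E : L) := g (kn_curvature nabla J X E Z) E.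
set X := fr x y z; set Y := fr x' y' z'.
(* Folding frames back into [e1], [e2], [e3] avoids the forward rewriting, which would also hit the
   basis vectors that [frame] takes as arguments. *)
transitivity (- K X Y (fr 1 0 0) - K X Y (fr 0 1 0) + K X Y (fr 0 0 1)).
  by rewrite -frame_e1 -frame_e2 -frame_e3.
rewrite /K /X /Y /kn_curvature !bracket_frame !kn_frame !(frameE e1 e2 e3).
by rewrite !(form_frame basis_e); ring.
Qed.

Lemma kn_ricci_operator_frame (Ric : 'End(L)) x y z :
  kn_ricci_operator g nabla J e1 e2 e3 Ric ->
  Ric (fr x y z) =
    fr (((2 * eta - beta) * beta - 1) * x)
       ((alpha * (2 * eta - beta) - 1) * y) (- (alpha * y)).
Proof.
move=> RicE; rewrite [LHS](frame_form basis_e) -!RicE !kn_ricci_frame.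
by congr (frame _ _ _ _ _ _); ring.
Qed.

End G4.

Lemma derivation_system_inconsistent (R : realType) (alpha beta eta c : R) :
  eta = 1 \/ eta = -1 ->
  c = (2 * eta - beta) * beta - 1 - alpha * beta ->
  (alpha * (2 * eta - beta) - 1) * beta
    = ((2 * eta - beta) * beta - 1 - c) * beta ->
  2 * alpha = (2 * eta - beta) * ((2 * eta - beta) * (alpha + beta) - 2 - c) ->
  alpha * ((2 * eta - beta) * (alpha - beta) - c) = 0 ->
  False.
Proof.
move=> eta_sign cE.
set t := beta - eta => h13 h12 h23.
have : beta * (2 * alpha * t + 1) = 0.
  (* Fixing the sign of [eta] builds in [eta ^+ 2 = 1]; the claim is then linear in the monomials in
     [alpha] and [beta]. *)
  by rewrite cE in h13; case: eta_sign => eE; rewrite /t eE in h13 *; lra.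
have eq12 : (2 * eta - beta) + 2 * alpha * eta * t = 0.
  by rewrite cE in h12; case: eta_sign => eE; rewrite /t eE in h12 *; lra.
have eq23 : alpha * (1 - 2 * t ^+ 2 - 2 * alpha * eta) = 0.
  by rewrite cE in h23; case: eta_sign => eE; rewrite /t eE in h23 *; lra.
move=> /eqP; rewrite mulf_eq0 => /orP[]/eqP eq13.
  rewrite /t eq13 in eq12 eq23.
  have aE : alpha = eta by case: eta_sign => eE; rewrite eE in eq12 *; lra.
  (* With [t = - eta] and [alpha = eta], [eq23] reads [- 3 * eta = 0]. *)
  by rewrite aE in eq23; case: eta_sign => eE; rewrite eE in eq23; lra.
(* Here [2 * alpha * t = -1] reduces [eq12] to [(2 * eta - beta) - eta = 0], whose left side is
   [- t]. *)
have tE : t = 0.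
  by rewrite /t; case: eta_sign => eE; rewrite /t eE in eq12 eq13 *; lra.
by rewrite tE in eq13; lra.
Qed.

Theorem theorem2p38 (R : realType) (alpha beta eta : R)
    (eta_sign : eta = 1 \/ eta = -1)
    (L : lieAlgebra R) (g : {symmetric L}) (e1 e2 e3 : L)
    (basis_e : pseudo_orthonormal_basis g e1 e2 e3)
    (bracket12 : bracket e1 e2 = - e2 + (2 * eta - beta) *: e3)
    (bracket13 : bracket e1 e3 = - beta *: e2 + e3)
    (bracket23 : bracket e2 e3 = alpha *: e1)
    (J : 'End(L)) (J_prod : product_structure J e1 e2 e3)
    (nabla : {bilinear L -> L -> L}) (nabla_LC : levi_civita g nabla)
    (Ric1 : 'End(L)) (Ric1_def : kn_ricci_operator g nabla J e1 e2 e3 Ric1) :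
  ~ first_kind_algebraic_ricci_soliton Ric1.
Proof.
move=> [c [D [derD defRic]]].
have RicE x y z := kn_ricci_operator_frame basis_e bracket12 bracket13
  bracket23 J_prod nabla_LC x y z Ric1_def.
have DE x y z : D (frame e1 e2 e3 x y z) =
    frame e1 e2 e3 (((2 * eta - beta) * beta - 1 - c) * x)
      ((alpha * (2 * eta - beta) - 1 - c) * y) (- (alpha * y) - c * z).
  have -> : D = Ric1 - c *: \1%VF by rewrite defRic addrC addKr.
  rewrite add_lfunE opp_lfunE scale_lfunE id_lfunE RicE !(frameE e1 e2 e3).
  by congr (frame _ _ _ _ _ _); ring.
have brE := bracket_frame bracket12 bracket13 bracket23.
have derE x y z x' y' z' :=
  derD (frame e1 e2 e3 x y z) (frame e1 e2 e3 x' y' z').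
have := derE 1 0 0 0 1 0; have := derE 1 0 0 0 0 1; have := derE 0 1 0 0 0 1.
(* The second pass of [DE] serves [D] of a bracket, which becomes [D] of a frame only after
   [brE]. *)
rewrite !DE !brE !DE !(frameE e1 e2 e3).
(* Four coordinates of the derivation rule are kept: along [e1] for [[e2, e3]], along [e2] for
   [[e1, e3]], and along [e2] and [e3] for [[e1, e2]]. *)
move=> /(frame_inj basis_e)[h23 _ _] /(frame_inj basis_e)[_ h13 _].
move=> /(frame_inj basis_e)[_ h12 h12'].
apply: (@derivation_system_inconsistent R alpha beta eta c) => //.
- by move: h12; clear; lra.
- by move: h13; clear; lra.
- by move: h12'; clear; lra.
- by move: h23; clear; lra.
Qed.
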